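(* Let $\Omega\subset\mathbb{T}$ be a domain and let $\boldsymbol{F}$ be a family of bicomplex meromorphic functions on $\Omega$. Then $\boldsymbol{F}$ is normal in $\Omega$ with respect to the bicomplex chordal metric $\chi_e$ if and only if, for each $i\in\{1,2\}$, the family of meromorphic functions $F_{ei}=\mathcal{P}_i(\boldsymbol{F}):=\{f_{ei} : f\in\boldsymbol{F}\}$ is normal in $\mathcal{P}_i(\Omega)$ with respect to the chordal metric $\chi$.
   Context: Bicomplex numbers: $\mathbb{T}=\{z_1+z_2\mathbf{i_2} : z_1,z_2\in\mathbb{C}(\mathbf{i_1})\}$, where $\mathbb{C}(\mathbf{i_1})=\{x+y\mathbf{i_1}: x,y\in\mathbb{R}\}$ is the field of complex numbers with imaginary unit $\mathbf{i_1}$, $\mathbf{i_1}^2=\mathbf{i_2}^2=-1$, $\mathbf{i_1}\mathbf{i_2}=\mathbf{i_2}\mathbf{i_1}=\mathbf{j}$, $\mathbf{j}^2=1$; $\mathbb{T}$ is identified with $\mathbb{R}^4$ and carries the Euclidean topology. The projections $\mathcal{P}_1,\mathcal{P}_2:\mathbb{T}\to\mathbb{C}(\mathbf{i_1})$ are $\mathcal{P}_1(z_1+z_2\mathbf{i_2})=z_1-z_2\mathbf{i_1}$, $\mathcal{P}_2(z_1+z_2\mathbf{i_2})=z_1+z_2\mathbf{i_1}$. With $\mathbf{e_1}=(1+\mathbf{j})/2$, $\mathbf{e_2}=(1-\mathbf{j})/2$, every $w\in\mathbb{T}$ is uniquely $w=\mathcal{P}_1(w)\mathbf{e_1}+\mathcal{P}_2(w)\mathbf{e_2}$,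 and the ring operations act componentwise. A domain is a nonempty open connected set. Extended bicomplex plane: $\overline{\mathbb{T}}$ is the set of all formal $w=w_1\mathbf{e_1}+w_2\mathbf{e_2}$ with $w_1,w_2\in\overline{\mathbb{C}(\mathbf{i_1})}=\mathbb{C}(\mathbf{i_1})\cup\{\infty\}$; $\mathcal{P}_i(w)=w_i$ extends the projections to $\overline{\mathbb{T}}$. Chordal metrics: $\chi$ is the chordal metric on $\overline{\mathbb{C}(\mathbf{i_1})}$, $\chi(a,b)=\frac{|a-b|}{\sqrt{1+|a|^2}\sqrt{1+|b|^2}}$ for finite $a,b$, $\chi(a,\infty)=\frac{1}{\sqrt{1+|a|^2}}$ for finite $a$, $\chi(\infty,\infty)=0$. The bicomplex chordal metric on $\overline{\mathbb{T}}$ is $\chi_e(z,w)=\sqrt{\frac{\chi^2(\mathcal{P}_1(z),\mathcal{P}_1(w))+\chi^2(\mathcal{P}_2(z),\mathcal{P}_2(w))}{2}}$. Bicomplex meromorphic functions: a function $f$ on an open set $\Omega\subset\mathbb{T}$ (with values in $\overline{\mathbb{T}}$) is bicomplex meromorphic if there are meromorphic functions $f_{e1}$ on $\mathcal{P}_1(\Omega)$ and $f_{e2}$ on $\mathcal{P}_2(\Omega)$ (taking the value $\infty$ at their poles) such that $f(w)=f_{e1}(\mathcal{P}_1(w))\mathbf{e_1}+f_{e2}(\mathcal{P}_2(w))\mathbf{e_2}$ for all $w\in\Omega$. Normality: a sequence $\{f_n\}$ of $\overline{\mathbb{T}}$-valued functions converges bispherically uniformly to $f$ on a set $E$ if for every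 $\epsilon>0$ there is $n_0$ with $\chi_e(f_n(w),f(w))<\epsilon$ for all $n\ge n_0$ and $w\in E$. A family $\boldsymbol{F}$ of bicomplex meromorphic functions in $\Omega$ is normal in $\Omega$ (with respect to $\chi_e$) if every sequence in $\boldsymbol{F}$ contains a subsequence which converges bispherically uniformly on compact subsets of $\Omega$ (to some $\overline{\mathbb{T}}$-valued function). A family of meromorphic functions on a domain $D\subset\mathbb{C}(\mathbf{i_1})$ is normal in $D$ with respect to $\chi$ if every sequence in it contains a subsequence which converges uniformly with respect to $\chi$ on compact subsets of $D$; the limit is then meromorphic or identically $\infty$. *)

(* Defs.v *)
From mathcomp Require Import all_boot all_order all_algebra.
From mathcomp Require Import complex.
From mathcomp Require Import all_classical all_reals all_analysis.

Set Implicit Arguments.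
Unset Strict Implicit.
Unset Printing Implicit Defensive.

Import Order.TTheory GRing.Theory Num.Theory.
Import numFieldNormedType.Exports.

Local Open Scope classical_set_scope.
Local Open Scope ring_scope.

(* R[i] as a structure, so that it inherits the topology and the normed module
   structure that every numClosedFieldType carries through its own norm. *)
Definition Cx (R : realType) : numClosedFieldType := R[i].

Definition i1 {R : realType} : Cx R := (0 +i* 1)%C.

(* The real-valued modulus; the norm `|z| takes its values in R[i]. *)
Definition modulus {R : realType} (z : Cx R) : R := ComplexField.Normc.normc z.

(* The pair (z1, z2) stands for z1 + z2 i2; the product topology is the
   Euclidean one. The library's componentwise product of pairs is not the
   bicomplex multiplication in these coordinates. *)
Notation bicomplex R := (Cx R * Cx R)%type.

Definition P1 {R : realType} (w : bicomplex R) : Cx R := w.1 - w.2 * i1.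
Definition P2 {R : realType} (w : bicomplex R) : Cx R := w.1 + w.2 * i1.

(* [None] is the point at infinity. *)
Definition Cbar (R : realType) : Type := option (Cx R).

(* Formal sums w1 e1 + w2 e2, where e1 = (1 + i1 i2) / 2, e2 = (1 - i1 i2) / 2,
   so that a finite w is P1 w e1 + P2 w e2. Unlike in [bicomplex], the coordinates here are
   the idempotent ones. *)
Record Tbar (R : realType) : Type :=
  Idempotent { Pbar1 : Cbar R ; Pbar2 : Cbar R }.

Definition chi {R : realType} (a b : Cbar R) : R :=
  match a, b with
  | Some z, Some w =>
      modulus (z - w)
      / (Num.sqrt (1 + modulus z ^+ 2) * Num.sqrt (1 + modulus w ^+ 2))
  | Some z, None | None, Some z => (Num.sqrt (1 + modulus z ^+ 2))^-1
  | None, None => 0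
  end.

Definition chi_e {R : realType} (z w : Tbar R) : R :=
  Num.sqrt ((chi (Pbar1 z) (Pbar1 w) ^+ 2 + chi (Pbar2 z) (Pbar2 w) ^+ 2) / 2).

(* The default value 0 is never used: finiteness is always required alongside. *)
Definition finite_part {R : realType} (a : Cbar R) : Cx R := odflt 0 a.

Definition finite_derivable {R : realType} (g : Cx R -> Cbar R) (z : Cx R) :=
  g z <> None /\ derivable (finite_part \o g) z 1.

Definition holomorphic_at {R : realType} (g : Cx R -> Cbar R) (z0 : Cx R) :=
  \forall z \near z0, finite_derivable g z.

Definition pole_at {R : realType} (g : Cx R -> Cbar R) (z0 : Cx R) :=
  [/\ g z0 = None,
      \forall z \near z0^', finite_derivable g z
    & modulus (finite_part (g z)) @[z --> z0^'] --> +oo].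

Definition meromorphic {R : realType} (D : set (Cx R)) (g : Cx R -> Cbar R) :=
  forall z, D z -> holomorphic_at g z \/ pole_at g z.

(* g1 and g2 are the components f_e1 and f_e2 of f; as total functions they are
   determined by f only on P1 @` Omega and P2 @` Omega. *)
Definition components {R : realType} (Omega : set (bicomplex R))
    (f : bicomplex R -> Tbar R) (g1 g2 : Cx R -> Cbar R) :=
  [/\ meromorphic (P1 @` Omega) g1, meromorphic (P2 @` Omega) g2
    & forall w, Omega w -> f w = Idempotent (g1 (P1 w)) (g2 (P2 w))].

Definition bicomplex_meromorphic {R : realType} (Omega : set (bicomplex R))
    (f : bicomplex R -> Tbar R) :=
  exists g1 g2, components Omega f g1 g2.

Definition family1 {R : realType} (Omega : set (bicomplex R))
    (F : set (bicomplex R -> Tbar R)) : set (Cx R -> Cbar R) :=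
  [set g1 | exists2 f, F f & exists g2, components Omega f g1 g2].

Definition family2 {R : realType} (Omega : set (bicomplex R))
    (F : set (bicomplex R -> Tbar R)) : set (Cx R -> Cbar R) :=
  [set g2 | exists2 f, F f & exists g1, components Omega f g1 g2].

Definition is_domain (T : topologicalType) (A : set T) :=
  [/\ A !=set0, open A & connected A].

Definition uniform_cvg_on {R : realType} (X Y : Type) (d : Y -> Y -> R)
    (E : set X) (f_ : nat -> X -> Y) (f : X -> Y) :=
  forall eps : R, 0 < eps -> exists n0 : nat,
    forall n w, (n0 <= n)%N -> E w -> d (f_ n w) (f w) < eps.

Definition normal_family {R : realType} (X : topologicalType) (Y : Type)
    (d : Y -> Y -> R) (Omega : set X) (F : set (X -> Y)) :=
  forall f_ : nat -> X -> Y, (forall n, F (f_ n)) ->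
  exists2 phi : nat -> nat, {homo phi : m n / (m < n)%N} &
  exists f : X -> Y, forall K : set X, compact K -> K `<=` Omega ->
    uniform_cvg_on d K (f_ \o phi) f.

(* Main.v *)
Require Import Defs.
From mathcomp Require Import all_boot all_order all_algebra.
From mathcomp Require Import all_classical all_reals all_analysis.
From mathcomp Require Import complex ring lra.

Import Order.TTheory GRing.Theory Num.Theory.
Import numFieldNormedType.Exports.
Local Open Scope classical_set_scope.
Local Open Scope ring_scope.

(** In idempotent coordinates everything splits. The metric chi_e is, up to
    constants, the larger of the two coordinate distances, so uniform convergence
    for chi_e is uniform convergence of both coordinates, and extracting a
    subsequence twice reduces the theorem to one coordinate at a time
    ([normal_family_chi_e]).

    The i-th coordinate of f is g o P with P = P1 or P2 and g = f_e1 or f_e2, and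
    it remains to compare normality of the functions g o P on Omega with
    normality of the functions g on P(Omega).

    If the g are normal, so are the g o P, because P maps a compact subset of
    Omega to a compact subset of P(Omega) ([normal_family_pullback]).

    Conversely, let g_n o P converge uniformly on compact subsets of Omega. The
    limit takes the same value at two points with the same projection, since
    limits for chi are unique by the triangle inequality ([chi_triangle],
    [chi_limit_unique]); hence it has the form g o P. A compact subset of
    P(Omega) need not come with a continuous lift into Omega, but P is affinely
    split through every point of Omega, so each of its points has a closed
    neighbourhood, relative to the compact set, that lifts to a compact subset of
    Omega. Finitely many of these neighbourhoods cover, and g_n converges
    uniformly to g on each of them ([uniform_cvg_on_descent],
    [normal_family_descent]). *)

(** * The chordal metric *)

(* modulus computes on 0 and 1, which would hide it from its own lemmas *)
#[local] Arguments modulus : simpl never.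

Section Chordal.
Variable R : realType.
Implicit Types (z w : Cx R) (a b c : Cbar R).

Lemma modulusM z w : modulus (z * w) = modulus z * modulus w.
Proof. exact: ComplexField.Normc.normcM. Qed.

Lemma modulusN z : modulus (- z) = modulus z.
Proof. exact: normcN. Qed.

Lemma modulus0 : modulus (0 : Cx R) = 0.
Proof. exact: ComplexField.Normc.normc0. Qed.

Lemma modulus1 : modulus (1 : Cx R) = 1.
Proof. exact: ComplexField.Normc.normc1. Qed.

Lemma ler_modulusD z w : modulus (z + w) <= modulus z + modulus w.
Proof. exact: le_normcD. Qed.

Lemma modulus_ge0 z : 0 <= modulus z.
Proof. by case: z => x y; exact: sqrtr_ge0. Qed.

Lemma modulus_eq0 z : modulus z = 0 -> z = 0.
Proof. exact: ComplexField.Normc.eq0_normc. Qed.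

(** Homogeneous coordinates on the Riemann sphere seen as a projective line;
    they turn the four cases of the chordal metric into a single formula. *)
Definition homog a : Cx R * Cx R := if a is Some z then (z, 1) else (1, 0).

Definition hnorm a : R :=
  Num.sqrt (modulus (homog a).1 ^+ 2 + modulus (homog a).2 ^+ 2).

Definition hdet a b : Cx R :=
  (homog a).1 * (homog b).2 - (homog a).2 * (homog b).1.

Lemma hnorm_sqr a :
  hnorm a ^+ 2 = modulus (homog a).1 ^+ 2 + modulus (homog a).2 ^+ 2.
Proof. by rewrite sqr_sqrtr// addr_ge0// sqr_ge0. Qed.

Lemma hnorm_gt0 a : 0 < hnorm a.
Proof.
rewrite sqrtr_gt0; case: a => [z|] /=; rewrite ?modulus1 ?modulus0.
  by rewrite ltr_wpDl ?sqr_ge0// expr1n.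
by rewrite ltr_wpDr ?sqr_ge0// expr1n.
Qed.

Lemma chiE a b : chi a b = modulus (hdet a b) / (hnorm a * hnorm b).
Proof.
have h1 z : hnorm (Some z) = Num.sqrt (1 + modulus z ^+ 2).
  by rewrite /hnorm/= modulus1 expr1n addrC.
have h0 : hnorm None = 1 by rewrite /hnorm/= modulus1 modulus0 expr1n expr0n addr0 sqrtr1.
case: a b => [z|] [w|]; rewrite /chi ?h1 ?h0 /hdet/=.
- by rewrite mulr1 mul1r.
- by rewrite mulr0 mulr1 sub0r modulusN modulus1 mulr1 mul1r.
- by rewrite mulr1 mul0r subr0 modulus1 mul1r mul1r.
- by rewrite mulr0 mul0r subr0 modulus0 mul0r.
Qed.

Lemma chi_ge0 a b : 0 <= chi a b.
Proof.
by rewrite chiE divr_ge0 ?modulus_ge0// mulr_ge0// ltW// hnorm_gt0.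
Qed.

Lemma chi_sym a b : chi a b = chi b a.
Proof.
rewrite !chiE (mulrC (hnorm b)) -(modulusN (hdet b a)); congr (modulus _ / _).
by rewrite /hdet opprB (mulrC (homog b).2) (mulrC (homog b).1).
Qed.

Lemma chi_eq0 a b : chi a b = 0 -> a = b.
Proof.
rewrite chiE => /eqP; rewrite mulf_eq0 invr_eq0 mulf_eq0.
rewrite !(gt_eqF (hnorm_gt0 _)) !orbF.
move=> /eqP/modulus_eq0; rewrite /hdet.
case: a b => [z|] [w|] //=; rewrite ?(mulr1, mul1r, mulr0, mul0r, subr0, sub0r).
- by move=> /eqP; rewrite subr_eq0 => /eqP ->.
- by move=> /eqP; rewrite oppr_eq0 oner_eq0.
- by move=> /eqP; rewrite oner_eq0.
Qed.

(** Minkowski's inequality in the plane, in the form that suits moduli of complex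
    coordinates: squaring and adding the two coordinate bounds leaves only the
    scalar product of (u1, u2) and (w1, w2) to estimate, by Cauchy-Schwarz. *)
Lemma norm_combination_le (x p q u1 u2 v1 v2 w1 w2 u v w : R) :
  0 <= x -> 0 <= p -> 0 <= q ->
  0 <= u -> 0 <= v -> 0 <= w ->
  0 <= v1 -> 0 <= v2 ->
  u ^+ 2 = u1 ^+ 2 + u2 ^+ 2 -> v ^+ 2 = v1 ^+ 2 + v2 ^+ 2 ->
  w ^+ 2 = w1 ^+ 2 + w2 ^+ 2 ->
  x * v1 <= p * u1 + q * w1 -> x * v2 <= p * u2 + q * w2 ->
  x * v <= p * u + q * w.
Proof.
move=> x0 p0 q0 u0 v0 w0 v10 v20 eu ev ew l1 l2.
have cs : u1 * w1 + u2 * w2 <= u * w.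
  rewrite (le_trans (ler_norm _))// -[leRHS]ger0_norm ?mulr_ge0//.
  rewrite -ler_sqr ?nnegrE// !real_normK ?num_real// exprMn eu ew.
  (* Lagrange's identity *)
  rewrite -subr_ge0 (_ : _ - _ = (u1 * w2 - u2 * w1) ^+ 2) ?sqr_ge0//; ring.
rewrite -ler_sqr ?nnegrE ?addr_ge0 ?mulr_ge0//.
have s1 : (x * v1) ^+ 2 <= (p * u1 + q * w1) ^+ 2.
  by rewrite ler_sqr ?nnegrE ?(le_trans _ l1) ?mulr_ge0.
have s2 : (x * v2) ^+ 2 <= (p * u2 + q * w2) ^+ 2.
  by rewrite ler_sqr ?nnegrE ?(le_trans _ l2) ?mulr_ge0.
have := ler_wpM2l (mulr_ge0 p0 q0) cs.
have -> : (x * v) ^+ 2 = (x * v1) ^+ 2 + (x * v2) ^+ 2.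
  by rewrite !exprMn ev mulrDr.
have -> : (p * u + q * w) ^+ 2
    = p ^+ 2 * (u1 ^+ 2 + u2 ^+ 2) + q ^+ 2 * (w1 ^+ 2 + w2 ^+ 2)
      + 2 * (p * q * (u * w)).
  by rewrite -eu -ew; ring.
move: s1 s2; lra.
Qed.

(** Cramer's rule in the plane expresses det(a, c) b as a combination of a and
    c with coefficients det(b, c) and det(a, b). Taking norms gives the triangle
    inequality, because chi is the modulus of the determinant of unit vectors. *)
Lemma chi_triangle a b c : chi a c <= chi a b + chi b c.
Proof.
have la := hnorm_gt0 a; have lb := hnorm_gt0 b; have lc := hnorm_gt0 c.
have := @norm_combination_le (modulus (hdet a c)) (modulus (hdet b c))
  (modulus (hdet a b)) _ _ _ _ _ _ _ _ _
  (modulus_ge0 _) (modulus_ge0 _) (modulus_ge0 _)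
  (ltW la) (ltW lb) (ltW lc) (modulus_ge0 _) (modulus_ge0 _)
  (hnorm_sqr a) (hnorm_sqr b) (hnorm_sqr c).
rewrite -!modulusM => /(_ _ _)/wrap[].
- rewrite (_ : hdet a c * _ = hdet b c * (homog a).1 + hdet a b * (homog c).1).
    exact: ler_modulusD.
  by rewrite /hdet; ring.
- rewrite (_ : hdet a c * _ = hdet b c * (homog a).2 + hdet a b * (homog c).2).
    exact: ler_modulusD.
  by rewrite /hdet; ring.
move=> cramer; rewrite !chiE.
rewrite -(ler_pM2r (mulr_gt0 (mulr_gt0 la lb) lc)).
rewrite (_ : _ / _ * _ = modulus (hdet a c) * hnorm b); last first.
  by field; rewrite !gt_eqF.
rewrite (_ : _ * (_ * _ * _)
  = modulus (hdet b c) * hnorm a + modulus (hdet a b) * hnorm c)//.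
by field; rewrite !gt_eqF.
Qed.

Lemma chi_limit_unique a b :
  (forall eps : R, 0 < eps -> exists c, chi c a < eps /\ chi c b < eps) -> a = b.
Proof.
move=> ab; apply: chi_eq0; apply/eqP; rewrite eq_le chi_ge0 andbT.
apply/ler_addgt0Pr => e e0; rewrite add0r.
have [c [ca cb]] := ab (e / 2) (divr_gt0 e0 (ltr0Sn R 1)).
rewrite (le_trans (chi_triangle a c b))// (chi_sym a) (splitr e).
by rewrite lerD ?ltW.
Qed.

End Chordal.

(** * Uniform convergence and subsequences *)

Lemma leq_subseq (phi : nat -> nat) :
  {homo phi : m n / (m < n)%N} -> forall n, (n <= phi n)%N.
Proof.
by move=> hphi; elim=> [//|n IH]; rewrite (leq_ltn_trans IH)// hphi.
Qed.

Lemma uniform_cvg_on_subseq {R : realType} (X Y : Type) (d : Y -> Y -> R)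
    (E : set X) f_ f (phi : nat -> nat) :
  {homo phi : m n / (m < n)%N} ->
  uniform_cvg_on d E f_ f -> uniform_cvg_on d E (f_ \o phi) f.
Proof.
move=> hphi cf e /cf[n0 h]; exists n0 => n w n0n Ew; apply: h => //.
exact: leq_trans n0n (leq_subseq _ hphi n).
Qed.

Lemma chi_e_uniform_cvg {R : realType} (X : Type) (E : set X)
    (f_ : nat -> X -> Tbar R) (f : X -> Tbar R) :
  uniform_cvg_on chi_e E f_ f <->
  uniform_cvg_on chi E (fun n => @Pbar1 R \o f_ n) (@Pbar1 R \o f) /\
  uniform_cvg_on chi E (fun n => @Pbar2 R \o f_ n) (@Pbar2 R \o f).
Proof.
split=> [cf|[c1 c2] e e0].
  (* each coordinate of chi_e is at most 2 chi_e, a crude but sufficient bound *)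
  have bnd (x y e : R) : 0 <= x -> 0 <= e ->
      Num.sqrt ((x ^+ 2 + y ^+ 2) / 2) < e / 2 -> x < e.
    move=> x0 e0; apply: contraTT; rewrite -!leNgt => ex.
    rewrite -ler_sqr ?nnegrE ?sqrtr_ge0 ?divr_ge0// sqr_sqrtr; last first.
      by rewrite divr_ge0// addr_ge0// sqr_ge0.
    have : e ^+ 2 <= x ^+ 2 by rewrite ler_sqr ?nnegrE.
    have := sqr_ge0 y; have := sqr_ge0 x; rewrite expr_div_n; lra.
  split=> e e0; have [n0 h] := cf (e / 2) (divr_gt0 e0 (ltr0Sn R 1));
    exists n0 => n w n0n Ew; have := h n w n0n Ew; rewrite /chi_e.
    by apply: bnd => //; [exact: chi_ge0|exact: ltW].
  by rewrite addrC; apply: bnd => //; [exact: chi_ge0|exact: ltW].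
have [n1 h1] := c1 _ e0; have [n2 h2] := c2 _ e0.
exists (maxn n1 n2) => n w; rewrite geq_max => /andP[n1n n2n] Ew.
have := h1 n w n1n Ew; have := h2 n w n2n Ew.
rewrite /chi_e/=; move: (chi_ge0 _ (Pbar1 (f_ n w)) (Pbar1 (f w))).
move: (chi_ge0 _ (Pbar2 (f_ n w)) (Pbar2 (f w))).
move: (chi _ _) => y; move: (chi _ _) => x y0 x0 ye xe.
rewrite -ltr_sqr ?nnegrE ?sqrtr_ge0 ?(ltW e0)// sqr_sqrtr; last first.
  by rewrite divr_ge0// addr_ge0// sqr_ge0.
have : x ^+ 2 < e ^+ 2 by rewrite ltr_sqr ?nnegrE ?(ltW e0).
have : y ^+ 2 < e ^+ 2 by rewrite ltr_sqr ?nnegrE ?(ltW e0).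
lra.
Qed.

(** From right to left, a subsequence that works for the first coordinate is
    refined by one that works for the second. *)
Lemma normal_family_chi_e {R : realType} (X : topologicalType) (Omega : set X)
    (F : set (X -> Tbar R)) :
  normal_family chi_e Omega F <->
  normal_family chi Omega [set @Pbar1 R \o f | f in F] /\
  normal_family chi Omega [set @Pbar2 R \o f | f in F].
Proof.
split=> [nF|[n1 n2] f_ Ff].
  split=> g_ /(_ _)/cid2-/all_sig2[f_ Ff fg];
    have [phi hphi [f cf]] := nF f_ Ff; exists phi => //.
    exists (@Pbar1 R \o f) => K cK KO.
    have [c _] := (chi_e_uniform_cvg _ _ _ _).1 (cf K cK KO).
    by move=> e /c[n0 h]; exists n0 => n w ? ?; rewrite /comp -fg; exact: h.
  exists (@Pbar2 R \o f) => K cK KO.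
  have [_ c] := (chi_e_uniform_cvg _ _ _ _).1 (cf K cK KO).
  by move=> e /c[n0 h]; exists n0 => n w ? ?; rewrite /comp -fg; exact: h.
have [|phi hphi [g1 c1]] := n1 (fun n => @Pbar1 R \o f_ n).
  by move=> n; exists (f_ n).
have [|psi hpsi [g2 c2]] := n2 (fun n => @Pbar2 R \o f_ (phi n)).
  by move=> n; exists (f_ (phi n)).
exists (phi \o psi) => [m n mn|]; first exact/hphi/hpsi.
exists (fun w => Idempotent (g1 w) (g2 w)) => K cK KO.
apply/chi_e_uniform_cvg; split; last exact: c2.
exact: (uniform_cvg_on_subseq _ _ _ _ _ _ _ hpsi (c1 K cK KO)).
Qed.

(** * Normality along a map with local sections *)

Lemma normal_family_pullback {R : realType} (X Y : topologicalType) (Z : Type)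
    (d : Z -> Z -> R) (p : X -> Y) (Omega : set X)
    (G : set (X -> Z)) (H : set (Y -> Z)) :
  continuous p ->
  (forall g, G g -> exists2 h, H h & forall w, Omega w -> g w = h (p w)) ->
  normal_family d (p @` Omega) H -> normal_family d Omega G.
Proof.
move=> cp GH nH g_ Gg.
have /all_sig2[h_ Hh gh] n := cid2 (GH _ (Gg n)).
have [phi hphi [h ch]] := nH h_ Hh.
exists phi => //; exists (h \o p) => K cK KO e e0.
have [|n0 hn] := ch (p @` K) _ (image_subset p KO) e e0.
  by apply: continuous_compact => //; exact: continuous_subspaceT.
exists n0 => n w n0n Kw /=; rewrite gh; last exact: KO.
by apply: hn => //; exists w.
Qed.

(** Let y be a point of L over w in Omega. The preimage of Omega under the section
    through w is a neighbourhood of y, and by regularity it contains a closed one,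
    closure V. The part of L in closure V is compact, so the section maps it to a
    compact subset of Omega, on which convergence is uniform by hypothesis; this
    is uniform convergence near y, and compactness of L makes it global. Lifting
    pieces of L itself avoids asking X to be locally compact. *)
Lemma uniform_cvg_on_descent {R : realType} (X : topologicalType)
    (Y : uniformType) (Z : Type) (d : Z -> Z -> R) (p : X -> Y)
    (s : X -> Y -> X) (Omega : set X) (h_ : nat -> Y -> Z) (h : Y -> Z) :
  (forall w, continuous (s w)) -> (forall w, s w (p w) = w) ->
  (forall w, cancel (s w) p) -> open Omega ->
  (forall K, compact K -> K `<=` Omega ->
     uniform_cvg_on d K (fun n => h_ n \o p) (h \o p)) ->
  forall L, compact L -> L `<=` p @` Omega -> uniform_cvg_on d L h_ h.
Proof.
move=> cs sp ps oO ch L cL LO e e0.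
pose good n y := L y -> forall m, (n <= m)%N -> d (h_ m y) (h y) < e.
suff [n0 _ h0] : \forall n \near \oo, L `<=` good n.
  by exists n0 => n y n0n Ly; apply: (h0 n0) => //=.
apply: (proj1 (compact_near_coveringP L)) => // y Ly.
have [w Ow pwy] := LO y Ly.
have [|V nV clV] := @uniform_regular Y y (s w @^-1` Omega).
  by apply: cs; rewrite -pwy sp; exact: open_nbhs_nbhs.
have [||n0 hn] := ch (s w @` (L `&` closure V)) _ _ e e0.
- apply: continuous_compact; first exact/continuous_subspaceT/cs.
  exact/compact_closedI/closed_closure.
- by move=> _ [z [_ Vz] <-]; exact: clV.
exists (V, [set n | n0 <= n]%N); first by split => //; exists n0.
move=> [z n] [/= Vz n0n] Lz m nm.
rewrite -(ps w z); apply: hn; first exact: leq_trans nm.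
by exists z => //; split=> //; exact: subset_closure.
Qed.

(** The limit on Omega is constant on the fibres of p because limits are unique,
    so it factors through p. *)
Lemma normal_family_descent {R : realType} (X : topologicalType)
    (Y : uniformType) (Z : Type) (d : Z -> Z -> R) (p : X -> Y)
    (s : X -> Y -> X) (Omega : set X) (G : set (X -> Z)) (H : set (Y -> Z)) :
  (forall a b, (forall eps : R, 0 < eps ->
     exists c, d c a < eps /\ d c b < eps) -> a = b) ->
  (forall w, continuous (s w)) -> (forall w, s w (p w) = w) ->
  (forall w, cancel (s w) p) -> open Omega ->
  (forall h, H h -> exists2 g, G g & forall w, Omega w -> g w = h (p w)) ->
  normal_family d Omega G -> normal_family d (p @` Omega) H.
Proof.
move=> dU cs sp ps oO HG nG h_ Hh.
have /all_sig2[g_ Gg gh] n := cid2 (HG _ (Hh n)).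
have [phi hphi [g cg]] := nG g_ Gg.
have fibre w w' : Omega w -> Omega w' -> p w = p w' -> g w = g w'.
  move=> Ow Ow' pww'; apply: dU => e e0.
  have sub v : Omega v -> [set v] `<=` Omega by move=> ? _ ->.
  have [n1 h1] := cg _ (compact_set1 (x := w)) (sub _ Ow) e e0.
  have [n2 h2] := cg _ (compact_set1 (x := w')) (sub _ Ow') e e0.
  pose n := maxn n1 n2; exists (h_ (phi n) (p w)); split.
    by rewrite -gh//; apply: h1 => //; exact: leq_maxl.
  by rewrite pww' -gh//; apply: h2 => //; exact: leq_maxr.
have /choice[h gE] y : exists c, forall w, Omega w -> p w = y -> g w = c.
  have [[v [Ov pv]]|nov] := pselect (exists v, Omega v /\ p v = y).
    by exists (g v) => w Ow pw; apply: fibre => //; rewrite pw.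
  (* off the image of Omega any value will do *)
  by exists (h_ 0%N y) => w Ow pw; case: nov; exists w.
exists phi => //; exists h.
apply: (uniform_cvg_on_descent _ _ _ _ _ _ _ _ _ cs sp ps oO) => K cK KO e e0.
have [n0 hn] := cg K cK KO e e0; exists n0 => n w n0n Kw /=.
by rewrite -(gE (p w) w)// -?gh; [exact: hn|exact: KO|exact: KO].
Qed.

(** * The two projections *)

Section Projections.
Variable R : realType.
Implicit Types w v : bicomplex R.

Lemma P1_continuous : continuous (@P1 R).
Proof.
move=> w; apply: cvgB; first exact: cvg_fst.
by apply: cvgMr_tmp; exact: cvg_snd.
Qed.

Lemma P2_continuous : continuous (@P2 R).
Proof.
move=> w; apply: cvgD; first exact: cvg_fst.
by apply: cvgMr_tmp; exact: cvg_snd.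
Qed.

(** The section of a projection through w keeps the second coordinate of w and
    solves for the first. *)
Definition P1_section w (z : Cx R) : bicomplex R := (z + w.2 * i1, w.2).
Definition P2_section w (z : Cx R) : bicomplex R := (z - w.2 * i1, w.2).

Lemma P1_sectionK w : cancel (P1_section w) (@P1 R).
Proof. by move=> z; rewrite /P1/= addrK. Qed.

Lemma P2_sectionK w : cancel (P2_section w) (@P2 R).
Proof. by move=> z; rewrite /P2/= subrK. Qed.

Lemma P1_section_P1 w : P1_section w (P1 w) = w.
Proof. by case: w => a b; rewrite /P1_section/P1/= subrK. Qed.

Lemma P2_section_P2 w : P2_section w (P2 w) = w.
Proof. by case: w => a b; rewrite /P2_section/P2/= addrK. Qed.

Lemma P1_section_continuous w : continuous (P1_section w).
Proof.
move=> z.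
apply: (@cvg_pair _ _ _ (nbhs z) (nbhs (z + w.2 * i1)) (nbhs w.2)).
  by apply: cvgD; [exact: cvg_id|exact: cvg_cst].
exact: cvg_cst.
Qed.

Lemma P2_section_continuous w : continuous (P2_section w).
Proof.
move=> z.
apply: (@cvg_pair _ _ _ (nbhs z) (nbhs (z - w.2 * i1)) (nbhs w.2)).
  by apply: cvgB; [exact: cvg_id|exact: cvg_cst].
exact: cvg_cst.
Qed.

End Projections.

(** * The characterization of normality *)

(** The components g1 and g2 of f are unique only on the projections of Omega, so
    the two families need not be in bijection; it is enough that every member of
    either is matched by a member of the other. *)
Lemma normal_family1 (R : realType) (Omega : set (bicomplex R))
    (F : set (bicomplex R -> Tbar R)) :
  open Omega -> (forall f, F f -> bicomplex_meromorphic Omega f) ->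
  normal_family chi Omega [set @Pbar1 R \o f | f in F] <->
  normal_family chi (P1 @` Omega) (family1 Omega F).
Proof.
move=> oO mF; split.
  apply: (normal_family_descent _ _ _ _ _ (@P1_section R)) => //.
  - exact: chi_limit_unique.
  - exact: P1_section_continuous.
  - exact: P1_section_P1.
  - exact: P1_sectionK.
  - move=> g1 [f Ff [g2 [_ _ fE]]]; exists (@Pbar1 R \o f); first by exists f.
    by move=> w Ow /=; rewrite fE.
apply: normal_family_pullback; first exact: P1_continuous.
move=> _ [f Ff <-]; have [g1 [g2 cf]] := mF _ Ff.
exists g1; first by exists f => //; exists g2.
by case: cf => _ _ fE w Ow /=; rewrite fE.
Qed.

Lemma normal_family2 (R : realType) (Omega : set (bicomplex R))
    (F : set (bicomplex R -> Tbar R)) :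
  open Omega -> (forall f, F f -> bicomplex_meromorphic Omega f) ->
  normal_family chi Omega [set @Pbar2 R \o f | f in F] <->
  normal_family chi (P2 @` Omega) (family2 Omega F).
Proof.
move=> oO mF; split.
  apply: (normal_family_descent _ _ _ _ _ (@P2_section R)) => //.
  - exact: chi_limit_unique.
  - exact: P2_section_continuous.
  - exact: P2_section_P2.
  - exact: P2_sectionK.
  - move=> g2 [f Ff [g1 [_ _ fE]]]; exists (@Pbar2 R \o f); first by exists f.
    by move=> w Ow /=; rewrite fE.
apply: normal_family_pullback; first exact: P2_continuous.
move=> _ [f Ff <-]; have [g1 [g2 cf]] := mF _ Ff.
exists g2; first by exists f => //; exists g1.
by case: cf => _ _ fE w Ow /=; rewrite fE.
Qed.

Theorem theorem4p3 (R : realType) (Omega : set (bicomplex R))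
    (F : set (bicomplex R -> Tbar R)) :
  is_domain Omega ->
  (forall f, F f -> bicomplex_meromorphic Omega f) ->
  normal_family chi_e Omega F <->
  normal_family chi (P1 @` Omega) (family1 Omega F) /\
  normal_family chi (P2 @` Omega) (family2 Omega F).
Proof.
move=> [_ oO _] mF.
have n1 := normal_family1 _ _ _ oO mF; have n2 := normal_family2 _ _ _ oO mF.
split=> [/normal_family_chi_e[/n1 ? /n2 ?]|[/n1 ? /n2 ?]]; first by [].
exact/normal_family_chi_e.
Qed.
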